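(* Let $n\ge 3$ and $k\ge 5$ be integers. Then every set of functions $f_1,\dots,f_n$ (one per agent) that assigns agents to tasks so that every demand vector is exactly satisfied has maximum switching cost at least $3$.
   Context: There are $n$ agents, labelled $1,\dots,n$, and $k$ tasks, labelled $1,\dots,k$. A demand vector is a vector $\vec v=(v_1,\dots,v_k)$ of non-negative integers with $\sum_i v_i=n$. A set of functions $f_1,\dots,f_n$, each mapping demand vectors to $[k]=\{1,\dots,k\}$, is required to satisfy the demand: for every demand vector $\vec v$ and every task $j$, the number of agents $a$ with $f_a(\vec v)=j$ is exactly $v_j$. The switching cost of a pair $(\vec v,\vec v')$ is the number of agents $a$ with $f_a(\vec v)\neq f_a(\vec v')$. Two demand vectors are adjacent if $\|\vec v-\vec v'\|_1=2$, i.e. one is obtained from the other by moving one unit of demand from one task to another. The maximum switching cost of $f_1,\dots,f_n$ is the maximum switching cost over all pairs of adjacent demand vectors. *)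

(* Defs.v *)
(* Agents are 'I_n, tasks are 'I_k (labels shifted to 0..k-1). *)
From mathcomp Require Import all_boot.
Set Implicit Arguments. Unset Strict Implicit. Unset Printing Implicit Defensive.

Definition demand_vector (n k : nat) (v : 'I_k -> nat) : Prop :=
  \sum_(j < k) v j = n.

(* f a v = task assigned to agent a under demand vector v. *)
Definition satisfies_demand (n k : nat) (f : 'I_n -> ('I_k -> nat) -> 'I_k) : Prop :=
  forall v, demand_vector n v -> forall j : 'I_k, #|[pred a | f a v == j]| = v j.

Definition l1dist (k : nat) (v v' : 'I_k -> nat) : nat :=
  \sum_(j < k) ((v j - v' j) + (v' j - v j)).

Definition adjacent (k : nat) (v v' : 'I_k -> nat) : Prop := l1dist v v' = 2.

Definition switching_cost (n k : nat) (f : 'I_n -> ('I_k -> nat) -> 'I_k)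
  (v v' : 'I_k -> nat) : nat :=
  #|[pred a | f a v != f a v']|.

Definition max_switching_cost_ge (n k : nat) (f : 'I_n -> ('I_k -> nat) -> 'I_k) (c : nat) : Prop :=
  exists v v', [/\ demand_vector n v, demand_vector n v', adjacent v v' & c <= switching_cost f v v'].

(* Main.v *)
Require Import Defs.
From mathcomp Require Import all_boot zify.
Set Implicit Arguments. Unset Strict Implicit. Unset Printing Implicit Defensive.

(* Suppose that every switching cost is at most 2. Then moving one unit of demand
   from c to d either moves one agent from c to d, or moves one agent from c to
   an intermediate task l and another one from l to d.

   Fix two tasks o and p. Along the edge of demands supported on {o, p} the
   agents leave o one by one. An intermediate value argument along this edge
   gives n - 2 units u on {o, p} and two agents x, y such that, for three further
   tasks j, the demands u + o + j and u + p + j have x and y on the two extra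
   units and all other agents placed independently of j. The same then holds of
   u + i + j for distinct further tasks i, j.

   As n >= 3, write u = m + u'. Orient each pair {c, d} of the four tasks other
   than m from the task of x to the task of y in u + c + d. A directed path
   a -> b -> c forces x on a and y on c in u' + a + b + c. A tournament on four
   vertices has a Hamiltonian path a -> b -> c -> d; going from u' + a + b + c to
   u' + b + c + d then moves x from a to b and y from c to d, which is not an
   admissible move. *)

(* Demand vectors are multisets of tasks, represented by lists up to permutation. *)
Record frugal (A : finType) (T : eqType) (F : A -> seq T -> T) : Prop := Frugal {
  frugal_perm : forall a s s', perm_eq s s' -> F a s = F a s';
  frugal_demand : forall s, size s = #|A| ->
    forall j, #|[pred a | F a s == j]| = count_mem j s;
  frugal_cost : forall c d s, (size s).+1 = #|A| -> c != d ->
    #|[pred a | F a (c :: s) != F a (d :: s)]| <= 2 }.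

(** * Counting and uniqueness from exact demand *)

Section Frugal.
Variables (A : finType) (T : eqType) (F : A -> seq T -> T).
Hypothesis fF : frugal F.
Implicit Types (a b e x y : A) (c d i j m o p : T) (s u : seq T).

Lemma frugal_swap a c d s : F a (c :: d :: s) = F a (d :: c :: s).
Proof. by apply: (frugal_perm fF); apply/permP => P /=; lia. Qed.

Lemma frugal_rot3 a c d i s : F a (c :: d :: i :: s) = F a (i :: c :: d :: s).
Proof. by apply: (frugal_perm fF); apply/permP => P /=; lia. Qed.

Lemma frugal_mem a s : size s = #|A| -> F a s \in s.
Proof.
move=> sA; rewrite -has_pred1 has_count -(frugal_demand fF sA).
by apply/card_gt0P; exists a; rewrite inE.
Qed.

Lemma frugal_onto s j : size s = #|A| -> j \in s -> exists a, F a s = j.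
Proof.
move=> sA; rewrite -has_pred1 has_count -(frugal_demand fF sA).
by case/card_gt0P => a; rewrite inE => /eqP; exists a.
Qed.

Lemma frugal_inj s j a b : size s = #|A| -> count_mem j s <= 1 ->
  F a s = j -> F b s = j -> a = b.
Proof.
move=> sA; rewrite -(frugal_demand fF sA) => /card_le1_eqP inj Fa Fb.
by apply: inj; rewrite inE ?Fa ?Fb.
Qed.

Lemma no_three_moves c d s a b e : (size s).+1 = #|A| -> c != d ->
  uniq [:: a; b; e] ->
  F a (c :: s) != F a (d :: s) -> F b (c :: s) != F b (d :: s) ->
  F e (c :: s) != F e (d :: s) -> False.
Proof.
move=> sA cd abe Fa Fb Fe; have := frugal_cost fF sA cd.
rewrite leqNgt cardE => /negP; apply; apply: (uniq_leq_size abe) => z.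
by rewrite mem_enum !inE => /or3P[] /eqP ->.
Qed.

(** In the demand equations at [c :: s] and [d :: s], the agents other than [a] and [b] contribute
    equally and cancel. *)
Lemma frugal_balance c d s a b : (size s).+1 = #|A| -> a != b ->
  (forall e, e != a -> e != b -> F e (c :: s) = F e (d :: s)) ->
  forall j, (F a (c :: s) == j) + (F b (c :: s) == j) + (d == j) =
            (F a (d :: s) == j) + (F b (d :: s) == j) + (c == j).
Proof.
move=> sA ab fixed j.
have count_ab z : size z = #|A| ->
    count_mem j z = (F a z == j) + ((F b z == j) +
      \sum_(e | (e != a) && (e != b)) (F e z == j)).
  move=> zA; rewrite -(frugal_demand fF zA) -sum1_card big_mkcond /=.
  rewrite (bigD1 a) //= (bigD1 b) /=; last by rewrite eq_sym.
  rewrite !inE; congr (_ + (_ + _)); try by case: eqP.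
have := count_ab (c :: s) sA; have := count_ab (d :: s) sA.
rewrite (eq_bigr (fun e => nat_of_bool (F e (c :: s) == j))); last first.
  by move=> e /andP[ea eb]; rewrite fixed.
rewrite /=; lia.
Qed.

(** * The shape of a single move *)

(** The demand for [c] drops and that for [d] rises, so some [a] leaves [c] and some [b] enters [d].
    If [a = b], at most one other agent could switch, and [frugal_balance] forbids that lone switch;
    otherwise it identifies the task that [a] takes with the one that [b] gives up. *)
Lemma move_shape c d s : (size s).+1 = #|A| -> c != d ->
  exists a b, [/\ F a (c :: s) = c, F b (d :: s) = d,
    a = b \/ [/\ F a (d :: s) = F b (c :: s), F b (c :: s) != c
               & F b (c :: s) != d]
    & forall e, e != a -> e != b -> F e (c :: s) = F e (d :: s)].
Proof.
move=> sA cd.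
have [a /andP[/eqP Fac Fad]] : exists a, (F a (c :: s) == c) && (F a (d :: s) != c).
  apply/existsP; apply: contraT => /existsPn none.
  have /subset_leq_card : [pred a | F a (c :: s) == c] \subset [pred a | F a (d :: s) == c].
    by apply/subsetP => e; rewrite !inE => Fe; have := none e; rewrite Fe negbK.
  by rewrite !(frugal_demand fF) //= eqxx (eq_sym d) (negbTE cd) ltnn.
have [b /andP[/eqP Fbd Fbc]] : exists b, (F b (d :: s) == d) && (F b (c :: s) != d).
  apply/existsP; apply: contraT => /existsPn none.
  have /subset_leq_card : [pred a | F a (d :: s) == d] \subset [pred a | F a (c :: s) == d].
    by apply/subsetP => e; rewrite !inE => Fe; have := none e; rewrite Fe negbK.
  by rewrite !(frugal_demand fF) //= eqxx (negbTE cd) ltnn.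
exists a, b; have [eab|ab] := eqVneq a b.
  subst b; split=> //; first by left.
  move=> e ea _; apply/eqP; apply: contraT => Fe.
  have fixed e' : e' != a -> e' != e -> F e' (c :: s) = F e' (d :: s).
    move=> e'a e'e; apply/eqP; apply: contraT => Fe'.
    case: (@no_three_moves c d s a e e') => //; last by rewrite Fac eq_sym.
    by rewrite /= !inE negb_or (eq_sym a) ea (eq_sym a) e'a eq_sym e'e.
  have := frugal_balance sA _ fixed (F e (c :: s)).
  rewrite eq_sym ea Fac Fbd eqxx (eq_sym (F e (d :: s))) (negbTE Fe) => /(_ isT); lia.
have fixed e : e != a -> e != b -> F e (c :: s) = F e (d :: s).
  move=> ea eb; apply/eqP; apply: contraT => Fe.
  case: (@no_three_moves c d s a b e) => //; first 1 last.
  - by rewrite Fac eq_sym.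
  - by rewrite Fbd.
  by rewrite /= !inE negb_or ab (eq_sym a) ea eq_sym eb.
have := frugal_balance sA ab fixed (F a (d :: s)).
rewrite Fac Fbd eqxx (eq_sym c) (negbTE Fad) => bal.
have Fab : F a (d :: s) = F b (c :: s) by apply/eqP; rewrite eq_sym; lia.
by split=> //; right; rewrite -Fab; split=> //; rewrite Fab.
Qed.

Lemma mover c d s e : (size s).+1 = #|A| -> c != d ->
  F e (d :: s) = F e (c :: s) \/ F e (c :: s) = c \/ F e (d :: s) = d.
Proof.
move=> sA cd; have [a [b [Fa Fb _ fixed]]] := move_shape sA cd.
have [->|ea] := eqVneq e a; first by right; left.
have [->|eb] := eqVneq e b; first by right; right.
by left; rewrite fixed.
Qed.

(** In a two-agent move the agent leaving [c] stops short of [d]; so here [b] is both the one who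
    leaves and the one who arrives. *)
Lemma direct_move c d s b : (size s).+1 = #|A| -> c != d ->
  F b (c :: s) = c -> F b (d :: s) = d ->
  forall e, e != b -> F e (d :: s) = F e (c :: s).
Proof.
move=> sA cd Fbc Fbd e eb.
have [a [b' [Fa Fb' ab' fixed]]] := move_shape sA cd.
have [] : a = b /\ b' = b; last by move=> ? ?; subst; rewrite fixed.
case: ab' => [eab|[Fab' Fb'c Fb'd]]; [subst b'|]; have [eba|ba] := eqVneq b a.
- by subst.
- by move: cd; rewrite -{1}Fbc -{1}Fbd fixed ?eqxx.
- by move: Fb'd; rewrite -Fab' -eba Fbd eqxx.
have [ebb'|bb'] := eqVneq b b'; first by move: Fb'c; rewrite -ebb' Fbc eqxx.
by move: cd; rewrite -{1}Fbc -{1}Fbd fixed ?eqxx.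
Qed.

(** * Directed paths in the tournament on tasks *)

(** The demand [[:: a, b, c & u]] is one move away from both given demands. By [mover], one of them
    leaves [x] only [a] or [c], the other only [b] or [a]; likewise [y] has [b] or [c], and [c] or
    [a]. *)
Lemma triple_path x y (m a b c : T) u : (size u).+3 = #|A| -> uniq [:: m; a; b; c] ->
  F x [:: a, b, m & u] = a -> F y [:: a, b, m & u] = b ->
  F x [:: b, c, m & u] = b -> F y [:: b, c, m & u] = c ->
  F x [:: a, b, c & u] = a /\ F y [:: a, b, c & u] = c.
Proof.
rewrite /= !inE !negb_or => uA /and4P[/and3P[ma mb mc] /andP[ab ac] bc _].
rewrite ![_ [:: a, b, m & u]]frugal_rot3 ![_ [:: b, c, m & u]]frugal_rot3.
move=> xab yab xbc ybc.
have := @mover m c [:: a, b & u] x uA mc; have := @mover m c [:: a, b & u] y uA mc.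
have := @mover m a [:: b, c & u] x uA ma; have := @mover m a [:: b, c & u] y uA ma.
rewrite -![F _ [:: c, a, b & u]]frugal_rot3 xab yab xbc ybc.
move: ma mb mc ab ac bc => /eqP ma /eqP mb /eqP mc /eqP ab /eqP ac /eqP bc.
by do 4 (case=> [?|[?|?]]); split; congruence.
Qed.

Lemma no_path4 x y (m a b c d : T) u : (size u).+3 = #|A| -> uniq [:: m; a; b; c; d] ->
  F x [:: a, b, m & u] = a -> F y [:: a, b, m & u] = b ->
  F x [:: b, c, m & u] = b -> F y [:: b, c, m & u] = c ->
  F x [:: c, d, m & u] = c -> F y [:: c, d, m & u] = d -> False.
Proof.
move=> uA; rewrite /= !inE !negb_or.
case/and5P=> /and4P[ma mb mc md] /and3P[ab ac ad] /andP[bc bd] cd _.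
move=> xab yab xbc ybc xcd ycd.
have uabc : uniq [:: m; a; b; c] by rewrite /= !inE !negb_or ma mb mc ab ac bc.
have ubcd : uniq [:: m; b; c; d] by rewrite /= !inE !negb_or mb mc md bc bd cd.
have [xabc yabc] := triple_path uA uabc xab yab xbc ybc.
have [xbcd ybcd] := triple_path uA ubcd xbc ybc xcd ycd.
rewrite frugal_rot3 in xbcd; rewrite frugal_rot3 in ybcd.
(* Here [x] goes from [a] to [b] and [y] from [c] to [d], so the intermediate task would have to be
   both [b] and [c]. *)
have [a' [b' [Fa' Fb' ab' fixed]]] := @move_shape a d [:: b, c & u] uA ad.
move/eqP: ab => ab; move/eqP: ac => ac; move/eqP: bc => bc.
move/eqP: bd => bd; move/eqP: cd => cd.
have xa' : x = a'.
  apply/eqP; apply: contraT => xa'.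
  have [xb'|xb'] := eqVneq x b'; first by subst; congruence.
  by have := fixed x xa' xb'; congruence.
have yb' : y = b'.
  apply/eqP; apply: contraT => yb'.
  have [ya'|ya'] := eqVneq y a'; first by subst; congruence.
  by have := fixed y ya' yb'; congruence.
by subst; case: ab' => [?|[]]; congruence.
Qed.

Definition serves x y c d s :=
  (F x s == c) && (F y s == d) || (F x s == d) && (F y s == c).

Lemma serves_swap x y c d u :
  serves x y c d [:: c, d & u] = serves x y d c [:: d, c & u].
Proof. by rewrite /serves ![F _ [:: c, d & u]]frugal_swap orbC. Qed.

Lemma no_four_tasks x y m u (W : seq T) : (size u).+3 = #|A| ->
  uniq (m :: W) -> size W = 4 ->
  {in W &, forall c d, c != d -> serves x y c d [:: c, d, m & u]} -> False.
Proof.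
move=> uA; case/andP=> mW uW W4 servesW.
(* The diagonal is added to make the relation total, as sorting requires; it is discarded once the
   sorted list is known to be free of repetitions. *)
pose lt c d := (c == d) || (F x [:: c, d, m & u] == c) && (F y [:: c, d, m & u] == d).
have lt_total : {in W &, total lt}.
  move=> c d cW dW; rewrite /lt; have [//|cd /=] := eqVneq c d.
  by have := servesW c d cW dW cd; rewrite /serves ![F _ [:: d, c, m & u]]frugal_swap andbC.
(* Redei: merge sort along a tournament yields a Hamiltonian path. *)
have allW : all (mem W) W by apply/allP.
have := sort_sorted_in lt_total allW; have := size_sort lt W; rewrite W4.
have : uniq (m :: sort lt W) by rewrite /= mem_sort mW sort_uniq.
case: (sort lt W) => [|a [|b [|c [|d [|? ?]]]]] // uW' _ /=; rewrite /lt.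
have := uW'; rewrite /= !inE !negb_or => /and5P[_ /and3P[/negbTE-> _ _]].
case/andP=> /negbTE-> _ /negbTE-> _ /=.
case/and4P => /andP[/eqP xa /eqP yb] /andP[/eqP xb /eqP yc] /andP[/eqP xc /eqP yd] _.
exact: no_path4 uA uW' xa yb xb yc xc yd.
Qed.

(** * From the edge tasks to pairs of further tasks *)

(** Replacing [o] by [i] takes [x] from [j] to [i], so another agent leaves [o] for [j]. If [x]
    serves [j] next to [p] too, the same agent leaves [p] for [j]; were it not [y], [G] would place
    it on both [o] and [p]. If [y] serves [j] there, it must stay, as [x] already holds [i]. *)
Lemma serves_extend_from x y (G : A -> T) o p i j u : (size u).+2 = #|A| -> x != y ->
  uniq [:: i; j; o; p] -> i \notin u -> j \notin u ->
  (forall e, e != x -> e != y -> F e [:: o, j & u] = G e) ->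
  (forall e, e != x -> e != y -> F e [:: p, j & u] = G e) ->
  F x [:: o, j & u] = j -> F y [:: o, j & u] = o ->
  serves x y p j [:: p, j & u] ->
  F x [:: i, j & u] = i -> F y [:: i, j & u] = j.
Proof.
move=> uA xy; rewrite /= !inE !negb_or.
case/and4P=> /and3P[ij io ip] /andP[jo jp] op _ iu ju Go Gp xoj yoj srv xij.
have onei : count_mem i [:: i, j & u] <= 1.
  by rewrite /= eqxx eq_sym (negbTE ij) (count_memPn iu).
have onej : count_mem j [:: i, j & u] <= 1.
  by rewrite /= eqxx (negbTE ij) (count_memPn ju).
have oi : o != i by rewrite eq_sym.
have pi : p != i by rewrite eq_sym.
case/orP: srv => /andP[/eqP xp /eqP yp]; last first.
  have [a [b [Fa Fb ab fixed]]] := @move_shape o i [:: j & u] uA oi.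
  have [a' [b' [Fa' Fb' ab' fixed']]] := @move_shape p i [:: j & u] uA pi.
  have arrives q e e' : e = e' \/ [/\ F e [:: i, j & u] = F e' [:: q, j & u], 
      F e' [:: q, j & u] != q & F e' [:: q, j & u] != i] ->
      F e [:: q, j & u] = q -> q != j -> F x [:: q, j & u] = j ->
      F e' [:: i, j & u] = i -> F e [:: i, j & u] = j /\ e != x.
    move=> ee' Fe qj Fx Fe'.
    have e'x : e' = x by apply: (@frugal_inj [:: i, j & u] i).
    subst e'; case: ee' => [ex|[-> _ _]]; first by case/eqP: qj; congruence.
    by split=> //; apply: contraNneq qj => ex; rewrite -Fe ex Fx.
  have oj : o != j by rewrite eq_sym.
  have pj : p != j by rewrite eq_sym.
  have [Fai ax] := arrives o a b ab Fa oj xoj Fb.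
  have [Fa'i a'x] := arrives p a' b' ab' Fa' pj xp Fb'.
  have eaa' : a = a' by apply: (@frugal_inj [:: i, j & u] j).
  subst a'; have [<-//|ay] := eqVneq a y.
  by case/eqP: op; rewrite -Fa -Fa' Go ?Gp.
have [Fy|[Fy|Fy]] := @mover p i [:: j & u] y uA pi; first by rewrite Fy yp.
  by case/eqP: jp; rewrite -yp Fy.
by case/eqP: xy; apply: (@frugal_inj [:: i, j & u] i).
Qed.

Lemma servesC x y c d s : serves x y c d s = serves y x c d s.
Proof. by rewrite /serves orbC andbC [X in _ || X]andbC. Qed.

(** The roles of [x] and [y] are symmetric, so the agent [e] that goes from [j] to [i] may be taken
    to be [x]. *)
Lemma serves_extend_by x y (G : A -> T) o p i j u : (size u).+2 = #|A| -> x != y ->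
  uniq [:: i; j; o; p] -> i \notin u -> j \notin u ->
  (forall c e, c \in [:: o; p] -> e != x -> e != y -> F e [:: c, j & u] = G e) ->
  (forall c, c \in [:: o; p] -> serves x y c j [:: c, j & u]) ->
  forall e, e \in [:: x; y] -> F e [:: o, j & u] = j -> F e [:: i, j & u] = i ->
  serves x y i j [:: i, j & u].
Proof.
move=> uA xy U iu ju G1 srv e exy Fo Fi.
have oin : o \in [:: o; p] by rewrite inE eqxx.
have pin : p \in [:: o; p] by rewrite !inE eqxx orbT.
have oj : o != j by case/and4P: U => _; rewrite !inE negb_or eq_sym => /andP[].
wlog ex : x y xy G1 srv exy / e = x.
  move=> IH; move: (exy); rewrite !inE => /orP[]/eqP ee; first exact: (IH x y).
  rewrite servesC; apply: (IH y x) => //; first by rewrite eq_sym.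
  - by move=> *; apply: G1.
  - by move=> *; rewrite servesC srv.
  - by rewrite ee !inE eqxx.
subst e; apply/orP; left; rewrite Fi eqxx; apply/eqP.
have yo : F y [:: o, j & u] = o.
  case/orP: (srv o oin) => /andP[/eqP ? /eqP ?] //.
  by case/eqP: oj; congruence.
apply: (@serves_extend_from x y G o p) => //.
- by move=> *; apply: G1.
- by move=> *; apply: G1.
exact: srv.
Qed.

Lemma serves_extend x y (G : A -> T) o p i j u : (size u).+2 = #|A| -> x != y ->
  uniq [:: i; j; o; p] -> i \notin u -> j \notin u ->
  (forall c d e, c \in [:: o; p] -> d \in [:: i; j] ->
     e != x -> e != y -> F e [:: c, d & u] = G e) ->
  (forall c d, c \in [:: o; p] -> d \in [:: i; j] -> serves x y c d [:: c, d & u]) ->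
  serves x y i j [:: i, j & u].
Proof.
move=> uA xy U iu ju G1 srv.
have oin : o \in [:: o; p] by rewrite inE eqxx.
have iin : i \in [:: i; j] by rewrite inE eqxx.
have jin : j \in [:: i; j] by rewrite !inE eqxx orbT.
have U' : uniq [:: j; i; o; p].
  by move: U; rewrite -(@perm_uniq _ [:: i; j; o; p]) //; apply/permP => P /=; lia.
have [ij oi oj] : [/\ i != j, o != i & o != j].
  by move: U; rewrite /= !inE !negb_or => /and4P[/and3P[? ? _] /andP[? _] _ _]; split; rewrite // eq_sym.
have extj : forall e, e \in [:: x; y] -> F e [:: o, j & u] = j ->
    F e [:: i, j & u] = i -> serves x y i j [:: i, j & u].
  by apply: (@serves_extend_by x y G o p) => // *; [apply: G1 | apply: srv].
have exti : forall e, e \in [:: x; y] -> F e [:: o, i & u] = i ->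
    F e [:: j, i & u] = j -> serves x y j i [:: j, i & u].
  by apply: (@serves_extend_by x y G o p) => // *; [apply: G1 | apply: srv].
have server k : k \in [:: i; j] -> exists2 e, e \in [:: x; y] & F e [:: o, k & u] = k.
  move=> kin; case/orP: (srv o k oin kin) => /andP[/eqP Fx /eqP Fy].
    by exists y; rewrite // !inE eqxx orbT.
  by exists x; rewrite // !inE eqxx.
have [e exy Fe] := server j jin; have [e' e'xy Fe'] := server i iin.
(* The server [e] of [j] stays or goes to [i], and the server [e'] of [i] stays or goes to [j]. If
   one of them goes, the previous lemma applies; if both stay, they are distinct and hold [j] and
   [i]. *)
have [Fek|[Fek|]] := @mover o i [:: j & u] e uA oi; last exact: extj.
  2: by case/eqP: oj; congruence.
have [Fe'k|[Fe'k|Fe'k]] := @mover o j [:: i & u] e' uA oj.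
- have : e != e'.
    by apply: contraNneq ij => ee; rewrite -Fe' -Fe -Fek -Fe'k frugal_swap ee.
  rewrite Fe' frugal_swap in Fe'k; rewrite Fe in Fek.
  move: exy e'xy; rewrite !inE /serves.
  by move=> /orP[]/eqP ? /orP[]/eqP ?; subst; rewrite ?Fe'k ?Fek !eqxx ?orbT.
- by case/eqP: oi; congruence.
by rewrite serves_swap; apply: (exti e').
Qed.

(** * The intermediate value argument along an edge *)

(* The intermediate task of a two-agent move is occupied, so here it would be [o] or [p]. *)
Lemma edge_move o p s : (size s).+1 = #|A| -> o != p -> {subset s <= [:: o; p]} ->
  exists2 a, F a (o :: s) = o /\ F a (p :: s) = p
           & forall e, e != a -> F e (p :: s) = F e (o :: s).
Proof.
move=> sA op sop; have [a [b [Fa Fb ab fixed]]] := move_shape sA op.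
case: ab => [eab|[_ Fbo Fbp]]; first by subst b; exists a => // e ea; rewrite fixed.
have := @frugal_mem b (o :: s) sA; rewrite inE (negbTE Fbo) /= => /sop.
by rewrite !inE (negbTE Fbo) (negbTE Fbp).
Qed.

(* Moving one unit from [o] or [p] to a fresh task [j]: [b] is the agent serving
   [j] at [j :: s], and it is low (resp. high) if it was taken from [p] (resp.
   [o]) seen from both ends [o :: s] and [p :: s] of the edge. *)
Definition low o p s j := [exists b, (F b (o :: s) == p) && (F b (j :: s) == j)].
Definition high o p s j := [exists b, (F b (p :: s) == o) && (F b (j :: s) == j)].

(** Let [a] be the agent moved along the edge, [b] low for [i] and [b'] high for [j]. Both [b] and
    [b'] move directly, which fixes the others: from [i :: s] to [j :: s], [a] goes from [p] to [o],
    [b] from [i] to [p] and [b'] from [o] to [j], three switches. *)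
Lemma low_high o p s i j : (size s).+1 = #|A| -> o != p ->
  {subset s <= [:: o; p]} -> i \notin [:: o; p] -> j \notin [:: o; p] ->
  low o p s i -> high o p s j -> False.
Proof.
move=> sA op sop; rewrite !inE !negb_or => /andP[io ip] /andP[jo jp].
case/existsP=> b /andP[/eqP bo /eqP bi] /existsP[b' /andP[/eqP b'p /eqP b'j]].
have [a [ao ap] fixed] := edge_move sA op sop.
have ba : b != a by apply: contraNneq op => ba; rewrite -ao -ba bo.
have b'a : b' != a by apply: contraNneq op => e; rewrite -ap -e b'p.
have bp : F b (p :: s) = p by rewrite fixed.
have b'o : F b' (o :: s) = o by rewrite -fixed.
have bb' : b != b' by apply: contraNneq op => e; rewrite -b'o -e bo.
have pi : p != i by rewrite eq_sym.
have oj : o != j by rewrite eq_sym.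
have pib := direct_move sA pi bp bi; have ojb' := direct_move sA oj b'o b'j.
have ai : F a (i :: s) = p by rewrite pib // eq_sym.
have aj : F a (j :: s) = o by rewrite ojb' // eq_sym.
have b'i : F b' (i :: s) = o by rewrite pib // eq_sym.
have bj : F b (j :: s) = p by rewrite ojb'.
have ij : i != j by apply: contraNneq io => ij; rewrite -b'i ij b'j.
apply: (@no_three_moves i j s a b b') => //.
- by rewrite /= !inE !negb_or eq_sym ba eq_sym b'a bb'.
- by rewrite ai aj eq_sym.
- by rewrite bi bj.
by rewrite b'i b'j.
Qed.

(** The agents [x] and [y] are those carried from [o] to [p] in the two edge steps from
    [[:: o, o & u]] to [[:: p, p & u]]. Without low or high tasks in [J], the server of [j] comes
    directly from [o], respectively [p], and everyone else stays put. *)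
Lemma pivot o p (J : seq T) u : (size u).+2 = #|A| -> o != p ->
  {subset u <= [:: o; p]} -> {in J, forall j, j \notin [:: o; p]} ->
  {in J, forall j, ~~ low o p (o :: u) j} ->
  {in J, forall j, ~~ high o p (p :: u) j} ->
  exists (x y : A) (G : A -> T), [/\ x != y,
    forall c j e, c \in [:: o; p] -> j \in J -> e != x -> e != y ->
      F e [:: c, j & u] = G e
  & forall c j, c \in [:: o; p] -> j \in J -> serves x y c j [:: c, j & u]].
Proof.
move=> uA op uop Jop nlow nhigh.
have ouop : {subset o :: u <= [:: o; p]}.
  by move=> c; rewrite inE => /orP[/eqP->|/uop//]; rewrite inE eqxx.
have puop : {subset p :: u <= [:: o; p]}.
  by move=> c; rewrite inE => /orP[/eqP->|/uop//]; rewrite !inE eqxx orbT.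
have [x [xo xp] fixx] := @edge_move o p (o :: u) uA op ouop.
have [y [yo yp] fixy] := @edge_move o p (p :: u) uA op puop.
rewrite frugal_swap in xp.
have xy : x != y by apply: contraNneq op => e; have := yo; rewrite -e xp => ->.
have yoo : F y [:: o, o & u] = o by rewrite -fixx 1?eq_sym // frugal_swap.
have xpp : F x [:: p, p & u] = p by rewrite fixy.
pose G e := F e [:: o, o & u].
have Gpp e : e != x -> e != y -> F e [:: p, p & u] = G e.
  by move=> ex ey; rewrite fixy // frugal_swap fixx.
have Gop e : G e \in [:: o; p].
  by rewrite /G; apply: ouop; have := @frugal_mem e [:: o, o & u] uA; rewrite inE => /predU1P[->|//]; rewrite inE eqxx.
have ppop e : F e [:: p, p & u] \in [:: o; p].
  by apply: puop; have := @frugal_mem e [:: p, p & u] uA; rewrite inE => /predU1P[->|//]; rewrite inE eqxx.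
suff servers j : j \in J -> exists b b', [/\ b \in [:: x; y] /\ b' \in [:: x; y],
    F b [:: o, j & u] = j, F b' [:: p, j & u] = j,
    forall e, e != b -> F e [:: o, j & u] = G e
  & forall e, e != b' -> F e [:: p, j & u] = F e [:: p, p & u]].
  exists x, y, G; split=> // [c j e cop jJ ex ey|c j cop jJ];
    have [b [b' [[bxy b'xy] bj b'j Gb Gb']]] := servers j jJ;
    move: bxy b'xy cop; rewrite !inE.
    move=> /orP[]/eqP eb /orP[]/eqP eb' /orP[]/eqP->; subst;
      by rewrite ?Gb // Gb' // Gpp.
  have yx : y != x by rewrite eq_sym.
  move=> /orP[]/eqP eb /orP[]/eqP eb' /orP[]/eqP->; subst;
    rewrite /serves ?bj ?b'j ?Gb ?Gb' // /G ?yoo ?yp ?xpp ?xo !eqxx ?orbT //.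
move=> jJ; have [jo jp] : j != o /\ j != p.
  by have := Jop j jJ; rewrite !inE negb_or => /andP.
have [oj pj] : o != j /\ p != j by rewrite ![_ == j]eq_sym.
have [b bj] : exists b, F b [:: o, j & u] = j.
  by apply: frugal_onto => //; rewrite !inE eqxx orbT.
have [b' b'j] : exists b, F b [:: p, j & u] = j.
  by apply: frugal_onto => //; rewrite !inE eqxx orbT.
have bo : G b = o.
  have := Gop b; rewrite !inE => /orP[/eqP//|/eqP bp].
  by case/negP: (nlow j jJ); apply/existsP; exists b; rewrite -/(G b) bp eqxx frugal_swap bj eqxx.
have b'p : F b' [:: p, p & u] = p.
  have := ppop b'; rewrite !inE => /orP[/eqP b'o|/eqP//].
  by case/negP: (nhigh j jJ); apply/existsP; exists b'; rewrite b'o eqxx frugal_swap b'j eqxx.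
have Gb e : e != b -> F e [:: o, j & u] = G e.
  move=> eb; rewrite frugal_swap; apply: (@direct_move o j (o :: u) b) => //.
  by rewrite frugal_swap.
have Gb' e : e != b' -> F e [:: p, j & u] = F e [:: p, p & u].
  move=> eb; rewrite frugal_swap; apply: (@direct_move p j (p :: u) b') => //.
  by rewrite frugal_swap.
have three e : e != x -> e != y -> F e [:: o, j & u] != F e [:: p, j & u] ->
    F x [:: o, j & u] = F x [:: p, j & u] \/ F y [:: o, j & u] = F y [:: p, j & u].
  move=> ex ey Fe; have [->|Fx] := eqVneq (F x [:: o, j & u]) (F x [:: p, j & u]); first by left.
  have [->|Fy] := eqVneq (F y [:: o, j & u]) (F y [:: p, j & u]); first by right.
  case: (@no_three_moves o p (j :: u) x y e) => //.
  by rewrite /= !inE !negb_or xy ![_ == e]eq_sym ex ey.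
exists b, b'; split=> //; split.
  (* Otherwise, when [o] is replaced by [p] beside [j], [b] goes from [j] to [o] while [x] and [y]
     both leave [o]: three switches. The argument for [b'] is the mirror image. *)
  rewrite !inE -[_ || _]negbK negb_or; apply/negP => /andP[bx b_y].
  have bb' : b != b' by apply: contraNneq op => bb'; rewrite -b'p -bb' Gpp // bo.
  have xoj : F x [:: o, j & u] = o by rewrite Gb // eq_sym.
  have yoj : F y [:: o, j & u] = o by rewrite Gb // eq_sym.
  have Fpj e : F e [:: p, p & u] = p -> F e [:: p, j & u] != o.
    by move=> Fe; have [->|/Gb' ->] := eqVneq e b'; rewrite ?b'j ?Fe // eq_sym.
  case: (three b bx b_y) => [|Fx|Fy].
  - by rewrite bj Gb' // Gpp // bo.
  - by have := Fpj x xpp; rewrite -Fx xoj eqxx.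
  by have := Fpj y yp; rewrite -Fy yoj eqxx.
rewrite !inE -[_ || _]negbK negb_or; apply/negP => /andP[b'x b'y].
have bb' : b' != b by apply: contraNneq op => bb'; rewrite -b'p Gpp // bb' bo.
have xpj : F x [:: p, j & u] = p by rewrite Gb' // eq_sym.
have ypj : F y [:: p, j & u] = p by rewrite Gb' // eq_sym.
have Foj e : G e = o -> F e [:: o, j & u] != p.
  by move=> Fe; have [->|/Gb ->] := eqVneq e b; rewrite ?bj ?Fe.
case: (three b' b'x b'y) => [|Fx|Fy].
- by rewrite b'j Gb // -Gpp // b'p.
- by have := Foj x xo; rewrite Fx xpj eqxx.
by have := Foj y yoo; rewrite Fy ypj eqxx.
Qed.

(* Sliding along the edge from all demand on [o] to all demand on [p], nobody
   is low at the start and nobody is high at the end. *)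
Lemma pivot_exists o p (J : seq T) : 2 <= #|A| -> o != p ->
  {in J, forall j, j \notin [:: o; p]} ->
  exists u, [/\ (size u).+2 = #|A|, {subset u <= [:: o; p]},
    {in J, forall j, ~~ low o p (o :: u) j}
  & {in J, forall j, ~~ high o p (p :: u) j}].
Proof.
move=> A2 op Jop.
pose base r t := nseq t p ++ nseq r o.
have base_op r t : {subset base r t <= [:: o; p]}.
  move=> c; rewrite mem_cat !mem_nseq !inE.
  by case/orP=> /andP[_ ->]; rewrite ?orbT.
have size_base r t : size (base r t) = t + r by rewrite size_cat !size_nseq.
have lowE s s' j : perm_eq s s' -> low o p s j = low o p s' j.
  move=> ss'; apply: eq_existsb => b; congr ((_ == p) && (_ == j));
  by apply: (frugal_perm fF); rewrite perm_cons.
pose found u := {in J, forall j, ~~ low o p (o :: u) j} /\ {in J, forall j, ~~ high o p (p :: u) j}.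
(* Induction on the number [t] of units on [p], with two units of demand kept aside; the second
   alternative is the invariant carried along until a pivot is found. *)
suff slide t r : (t + r).+2 = #|A| ->
    (exists r' t', (t' + r').+2 = #|A| /\ found (base r' t')) \/
    {in J, forall j, ~~ low o p (o :: base r t) j}.
  have A2' : (#|A|.-2 + 0).+2 = #|A| by lia.
  case: (slide _ _ A2') => [[r [t [rtA [nlow nhigh]]]]|nlow].
    by exists (base r t); rewrite size_base; split.
  exists (base 0 #|A|.-2); rewrite size_base; split=> // j jJ.
  apply/existsPn => b; rewrite negb_and.
  have := @frugal_mem b [:: p, p & base 0 #|A|.-2].
  rewrite /= size_base !inE mem_cat !mem_nseq; have [->|_] := eqVneq (F b _) p.
    by rewrite eq_sym op.
  by rewrite !andbF => /(_ A2').
elim: t r => [|t IH] r rtA.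
  right=> j jJ; apply/existsPn => b; rewrite negb_and.
  have : F b (o :: o :: base r 0) \in nseq r.+2 o by apply: frugal_mem; rewrite /= size_base.
  by rewrite mem_nseq => /andP[_ /eqP->]; rewrite op.
have rtA' : (t + r.+1).+2 = #|A| by lia.
have [|nlow] := IH r.+1 rtA'; first by left.
have [/allP nhigh|] := boolP (all (fun j => ~~ high o p (p :: base r.+1 t) j) J).
  by left; exists r.+1, t.
(* A high [j] excludes every low [i] at the same base by [low_high], and this base is, up to
   permutation, the next one at which lowness is tested. *)
case/allPn=> j jJ; rewrite negbK => highj; right=> i iJ; apply/negP.
have perm_base : perm_eq (o :: base r t.+1) (p :: base r.+1 t).
  by apply/permP => P; rewrite /= !count_cat /=; lia.
rewrite (lowE _ _ i perm_base) => lowi.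
apply: (@low_high o p (p :: base r.+1 t) i j) => //; rewrite ?Jop //.
  by rewrite -rtA' -(size_base r.+1 t).
by move=> c; rewrite inE => /predU1P[->|/base_op//]; rewrite !inE eqxx orbT.
Qed.

Lemma frugal_lt5_tasks o p (J : seq T) : 2 < #|A| -> size J = 3 ->
  ~~ uniq [:: o, p & J].
Proof.
move=> A3 J3; apply/negP => U; have [op oJ pJ uJ] : [/\ o != p, o \notin J, p \notin J & uniq J].
  by case/and3P: U; rewrite inE negb_or => /andP[].
have Jop : {in J, forall j, j \notin [:: o; p]}.
  by move=> j jJ; rewrite !inE negb_or; apply/andP; split; apply: contraTneq jJ => ->.
have [u [uA uop nlow nhigh]] := pivot_exists (ltnW A3) op Jop.
have [x [y [G [xy rest srv]]]] := pivot uA op uop Jop nlow nhigh.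
have srv2 : {in J &, forall i j, i != j -> serves x y i j [:: i, j & u]}.
  move=> i j iJ jJ ij.
  have Ju k : k \in J -> k \notin u.
    by move=> kJ; apply/negP => /uop; apply/negP/Jop.
  have sub d : d \in [:: i; j] -> d \in J by rewrite !inE => /orP[]/eqP->.
  apply: (@serves_extend x y G o p i j) => //; first 1 last.
  - exact: Ju.
  - exact: Ju.
  - by move=> c d e cop /sub dJ; apply: rest.
  - by move=> c d cop /sub dJ; apply: srv.
  move: (Jop i iJ) (Jop j jJ); rewrite /= !inE !negb_or ij op.
  by move=> /andP[-> ->] /andP[-> ->].
(* Having at least three agents makes [u] nonempty; its head [m] is [o] or [p], and the other of
   these two joins [J] as the fourth task. *)
case: u {nlow nhigh rest} uA uop srv srv2 => [|m u] uA uop srv srv2.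
  by move: A3; rewrite -uA.
have mop : m \in [:: o; p] by apply: uop; rewrite inE eqxx.
pose w := if m == o then p else o.
have wop : w \in [:: o; p] by rewrite /w !inE; case: ifP; rewrite eqxx ?orbT.
have mwJ : uniq [:: m, w & J].
  move: mop; rewrite /w !inE => /orP[]/eqP->; rewrite ?eqxx // eq_sym (negbTE op).
  by rewrite /= inE negb_or eq_sym op oJ pJ.
apply: (@no_four_tasks x y m u (w :: J)) => //=; first by rewrite J3.
move=> c d; rewrite !inE => /predU1P[->|cJ] /predU1P[->|dJ] cd.
- by rewrite eqxx in cd.
- exact: srv.
- by rewrite serves_swap; apply: srv.
exact: srv2.
Qed.
End Frugal.

(** * Transfer to demand vectors *)

(** A finite function makes permuted lists give equal arguments to [f], which might otherwise
    distinguish functions that agree pointwise. *)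
Definition counts k (s : seq 'I_k) : {ffun 'I_k -> nat} := [ffun j => count_mem j s].

Lemma demand_counts k (s : seq 'I_k) : demand_vector (size s) (counts s).
Proof.
rewrite /demand_vector (eq_bigr (fun j => \sum_(i <- s) (i == j))) => [|j _]; last first.
  by rewrite ffunE -sum1_count big_mkcond; apply: eq_bigr => i _ /=; case: eqP.
rewrite exchange_big -sum1_size; apply: eq_bigr => i _ /=.
by rewrite (bigD1 i) //= eqxx big1 // => j; rewrite eq_sym => /negbTE->.
Qed.

Lemma adjacent_counts k (c d : 'I_k) s :
  c != d -> adjacent (counts (c :: s)) (counts (d :: s)).
Proof.
have one e : \sum_(j < k) (j == e) = 1.
  by rewrite (bigD1 e) //= eqxx big1 // => j /negbTE->.
move=> cd; rewrite /adjacent /l1dist (eq_bigr (fun j => (j == c) + (j == d))) => [|j _].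
  by rewrite big_split /= !one.
rewrite !ffunE /= ![_ == j]eq_sym.
by have [->|jc] := eqVneq j c; rewrite ?(negbTE cd); case: (j == d); lia.
Qed.

Lemma frugal_counts n k (f : 'I_n -> ('I_k -> nat) -> 'I_k) :
  satisfies_demand f ->
  (forall (c d : 'I_k) s, (size s).+1 = n -> c != d ->
    switching_cost f (counts (c :: s)) (counts (d :: s)) <= 2) ->
  frugal (fun a s => f a (counts s)).
Proof.
move=> fdem fcost; split=> [a s s' /permP ss'|s|]; rewrite ?card_ord //.
  by congr (f a (fun_of_fin _)); apply/ffunP => j; rewrite !ffunE.
by move=> sn j; rewrite fdem ?ffunE // -sn; apply: demand_counts.
Qed.

Theorem theorem1 (n k : nat) (hn : 3 <= n) (hk : 5 <= k)
  (f : 'I_n -> ('I_k -> nat) -> 'I_k) :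
  satisfies_demand f -> max_switching_cost_ge f 3.
Proof.
move=> fdem.
have [/existsP[s /existsP[c /existsP[d /andP[cd cost3]]]]|cheap] := boolP
  [exists s : n.-1.-tuple 'I_k, exists c, exists d,
    (c != d) && (2 < switching_cost f (counts (c :: s)) (counts (d :: s)))].
  have dem e : demand_vector n (counts (e :: s)).
    by have := demand_counts (e :: s); rewrite /= size_tuple prednK // ltnW // ltnW.
  by exists (counts (c :: s)), (counts (d :: s)); split=> //; apply: adjacent_counts.
have fF : frugal (fun a s => f a (counts s)).
  apply: frugal_counts => // c d s sn cd; rewrite leqNgt; apply: contra cheap => cost3.
  have sn' : size s == n.-1 by rewrite -sn.
  by apply/existsP; exists (Tuple sn'); apply/existsP; exists c; apply/existsP; exists d; rewrite cd.
(* The first five tasks suffice: two for the edge and three for [J]. *)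
pose t := [seq widen_ord hk i | i <- enum 'I_5].
have t5 : size t = 5 by rewrite size_map size_enum_ord.
have U5 : uniq t.
  by rewrite map_inj_uniq ?enum_uniq // => i j [ij]; apply: val_inj.
case: t t5 U5 => [|o [|p J]] // [J3] U.
have n3 : 2 < #|'I_n| by rewrite card_ord.
by have := frugal_lt5_tasks fF o p n3 J3; rewrite U.
Qed.
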